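(* Let $p\in[1,+\infty)$, let $(\Omega,\mathcal{F},\mu)$ be a probability space, let $L^p(\Omega,\mathcal{F},\mu;\mathbb{R})$ be the normed linear space of $p$-Lebesgue integrable functions with norm $\|\cdot\|_p$, equipped with the $\mu$-pointwise order, and let $\Phi:L^p(\Omega,\mathcal{F},\mu;\mathbb{R})\to\mathbb{R}\cup\{+\infty\}$ be an order preserving functional. Let $\mathbb{U}$ be a set and $g:\Omega\times\mathbb{U}\to\overline{\mathbb{R}}$ a function. Define $G:\mathbb{U}^\Omega\to\overline{\mathbb{R}}^\Omega$ by $G(\mathfrak{u})(\omega)=g(\omega,\mathfrak{u}(\omega))$ for all $\mathfrak{u}\in\mathbb{U}^\Omega$, $\omega\in\Omega$. Let $G^\flat\in\overline{\mathbb{R}}^\Omega$ be the function $G^\flat(\omega)=\inf_{u\in\mathbb{U}}g(\omega,u)$, and assume that $G^\flat\in L^p(\Omega,\mathcal{F},\mu;\mathbb{R})$. Let $\mathcal{U}\subset\mathbb{U}^\Omega$ be a subset. Suppose that: (S1) $X=G(\mathcal{U})$ is a subset of $L^p(\Omega,\mathcal{F},\mu;\mathbb{R})$; (S2) there exists a sequence $(\mathfrak{u}_n)_{n\in\mathbb{N}}$ in $\mathcal{U}$ such that (a) $\|G(\mathfrak{u}_n)-G^\flat\|_p\to0$ as $n\to+\infty$; (b) $\Phi(G^\flat)\ge\liminf_{n\to+\infty}\Phi(G(\mathfrak{u}_n))$. Then $$\inf_{x\in X}\Phi(x)=\Phi(G^\flat).$$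
   Context: $\overline{\mathbb{R}}=\mathbb{R}\cup\{\pm\infty\}$. The $\mu$-pointwise order is: $f\le h$ iff $f(\omega)\le h(\omega)$ for $\mu$-almost every $\omega$. Elements of $L^p$ are $\mu$-a.e. equivalence classes; a function $f\in\overline{\mathbb{R}}^\Omega$ is said to belong to $L^p$ if it represents such a class. $\Phi$ is order preserving if $f\le h$ implies $\Phi(f)\le\Phi(h)$. *)

(* Defs.v *)
From HB Require Import structures.
From mathcomp Require Import all_boot all_order all_algebra.
From mathcomp Require Import all_classical all_reals all_analysis.

Set Implicit Arguments.
Unset Strict Implicit.
Unset Printing Implicit Defensive.

Import Order.TTheory GRing.Theory Num.Theory.
Import numFieldNormedType.Exports.

Local Open Scope classical_set_scope.
Local Open Scope ring_scope.

Section Lp.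
Context d (T : measurableType d) (R : realType).
Variables (mu : {measure set T -> \bar R}) (p : \bar R) (p1 : (1 <= p)%E).
Implicit Types (f : T -> \bar R) (x y : LspaceType mu p1).

(* [f] itself need not be measurable, nor finite on a null set: it only has to
   agree almost everywhere with the real-valued measurable members of [x]. *)
Definition represents f x : Prop := \forall w \ae mu, f w = (x w)%:E.

Definition in_Lp f : Prop := exists x, represents f x.

Definition Lclass f (fLp : in_Lp f) : LspaceType mu p1 := projT1 (cid fLp).

Definition Lclasses (A : set (T -> \bar R)) : set (LspaceType mu p1) :=
  [set x | exists2 f, A f & represents f x].

Definition Lp_le x y : Prop := \forall w \ae mu, x w <= y w.

(* The norm of the difference of two classes: [LspaceType] carries no linear
   structure, so the difference is taken between representatives. *)
Definition Lp_dist x y : \bar R := 'N[mu]_p[(fun w => (x w - y w)%:E)]%E.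

Lemma represents_Lclass f (fLp : in_Lp f) : represents f (Lclass fLp).
Proof. exact: projT2 (cid fLp). Qed.

Lemma represents_inj f x y : represents f x -> represents f y -> x = y.
Proof.
move=> fx fy.
have xy : \forall w \ae mu, setT w -> x w = y w.
  near=> w => _; apply: EFin_inj.
  by rewrite -(near fx w _) ?(near fy w _).
have exy : LebesgueSpace.sort x = LebesgueSpace.sort y.
  have /ae_eqP/eqP := xy.
  by rewrite !reprK.
case: x y {fx fy xy} exy => [a [[ha]]] [b [[hb]]] /= ab.
by subst b; rewrite (Prop_irrelevance ha hb).
Unshelve. all: by end_near. Qed.

End Lp.

Arguments in_Lp {d T R} mu {p} p1 f.
Arguments Lclasses {d T R} mu {p} p1 A.

Section pointwise.
Context d (T : measurableType d) (R : realType) (U : Type).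
Variable g : T -> U -> \bar R.

Definition Gmap (v : T -> U) : T -> \bar R := fun w => g w (v w).

Definition Gflat : T -> \bar R := fun w => ereal_inf (range (g w)).

End pointwise.

(* Main.v *)
Require Import Defs.
From HB Require Import structures.
From mathcomp Require Import all_boot all_order all_algebra.
From mathcomp Require Import all_classical all_reals all_analysis.

Set Implicit Arguments.
Unset Strict Implicit.
Unset Printing Implicit Defensive.

Import Order.TTheory GRing.Theory Num.Theory.
Import numFieldNormedType.Exports.

Local Open Scope classical_set_scope.
Local Open Scope ring_scope.

(** The equality is a sandwich. Every [Gmap g v] dominates [Gflat g] pointwise, so monotonicity of
    [Phi] makes [Phi] at the class of [Gflat g] a lower bound of the image. Conversely, each term of
    the sequence from [S2] is at least the infimum, hence so is their liminf, which condition (b)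
    bounds by that same value of [Phi]. *)

(** Bridges the order on extended-valued functions and the order on classes, where [Phi] lives:
    outside a null set all values are real. *)
Lemma represents_le d (T : measurableType d) (R : realType)
    (mu : {measure set T -> \bar R}) (p : \bar R) (p1 : (1 <= p)%E)
    (f h : T -> \bar R) (x y : LspaceType mu p1) :
  (\forall w \ae mu, (f w <= h w)%E) ->
  represents f x -> represents h y -> Lp_le x y.
Proof.
by move=> fh fx hy; apply: filterS3 fh fx hy => w fhw fxw hyw;
  rewrite -lee_fin -fxw -hyw.
Qed.

(** The liminf is the limit of the infima of tails, each of which is bounded below by [a]. *)
Lemma ge_limn_einf (R : realType) (a : \bar R) (u : nat -> \bar R) :
  (forall n, (a <= u n)%E) -> (a <= limn_einf u)%E.
Proof.
move=> au; rewrite limn_einf_lim; apply: lime_ge; first exact: is_cvg_einfs.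
by near=> n; apply: le_ereal_inf_tmp => _ [k _ <-].
Unshelve. all: by end_near. Qed.

Theorem proposition12 (R : realType) (p : R) (p1 : (1 <= p%:E)%E)
    (d : measure_display) (Omega : measurableType d)
    (mu : probability Omega R)
    (Phi : LspaceType mu p1 -> \bar R)
    (Phi_neqNy : forall x, Phi x <> -oo%E)
    (Phi_mono : forall x y, Lp_le x y -> (Phi x <= Phi y)%E)
    (U : Type) (g : Omega -> U -> \bar R)
    (Gflat_Lp : in_Lp mu p1 (Gflat g))
    (calU : set (Omega -> U))
    (S1 : forall v, calU v -> in_Lp mu p1 (Gmap g v))
    (S2 : exists (u : nat -> (Omega -> U)) (uU : forall n, calU (u n)),
      (Lp_dist (Lclass (S1 (u n) (uU n))) (Lclass Gflat_Lp)
         @[n --> \oo] --> 0%E) /\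
      (limn_einf (fun n => Phi (Lclass (S1 (u n) (uU n))))
         <= Phi (Lclass Gflat_Lp))%E) :
  ereal_inf (Phi @` Lclasses mu p1 (Gmap g @` calU)) = Phi (Lclass Gflat_Lp).
Proof.
have [u [uU [_ liminf_le]]] := S2.
apply/eqP; rewrite eq_le; apply/andP; split.
  apply: le_trans liminf_le; apply: ge_limn_einf => n.
  apply: ereal_inf_lbound; exists (Lclass (S1 (u n) (uU n))) => //.
  by exists (Gmap g (u n)); [exists (u n) | exact: represents_Lclass].
(* Here [x] is any class represented by [Gmap g v], not necessarily the one chosen by [Lclass]. *)
apply: le_ereal_inf_tmp => _ [x [_ [v _ <-] vx] <-].
apply: Phi_mono; apply: represents_le vx; last exact: represents_Lclass.
(* The inequality holds at every [w]: [g w (v w)] is among the values whose infimum is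
   [Gflat g w]. *)
by apply: aeW => w; apply: ereal_inf_lbound; exists (v w).
Qed.
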